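(* Let $\mathcal{T}_1$ and $\mathcal{T}_2$ be $d$th-order real tensors of size $n_1\times\cdots\times n_d$. If the TR decompositions of these two tensors are $\mathcal{T}_1=\Re(\mathcal{Z}_1,\ldots,\mathcal{Z}_d)$, where $\mathcal{Z}_k\in\mathbb{R}^{r_k\times n_k\times r_{k+1}}$, and $\mathcal{T}_2=\Re(\mathcal{Y}_1,\ldots,\mathcal{Y}_d)$, where $\mathcal{Y}_k\in\mathbb{R}^{s_k\times n_k\times s_{k+1}}$, then the Hadamard product $\mathcal{T}_3=\mathcal{T}_1\circledast\mathcal{T}_2$ can also be represented in the TR format as $\mathcal{T}_3=\Re(\mathcal{X}_1,\ldots,\mathcal{X}_d)$, where $\mathcal{X}_k\in\mathbb{R}^{q_k\times n_k\times q_{k+1}}$ and $q_k=r_ks_k$. Each core $\mathcal{X}_k$ can be computed by $$\mathbf{X}_k(i_k)=\mathbf{Z}_k(i_k)\otimes\mathbf{Y}_k(i_k),\qquad i_k=1,\ldots,n_k,\quad k=1,\ldots,d.$$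
   Context: Tensor ring (TR) decomposition: given cores $\mathcal{Z}_k\in\mathbb{R}^{r_k\times n_k\times r_{k+1}}$, $k=1,\ldots,d$, with $r_{d+1}=r_1$, the notation $\mathcal{T}=\Re(\mathcal{Z}_1,\ldots,\mathcal{Z}_d)$ means that $\mathcal{T}\in\mathbb{R}^{n_1\times\cdots\times n_d}$ and $$T(i_1,\ldots,i_d)=\mathrm{Tr}\{\mathbf{Z}_1(i_1)\mathbf{Z}_2(i_2)\cdots\mathbf{Z}_d(i_d)\}\quad\text{for all } 1\le i_k\le n_k,$$ where $\mathbf{Z}_k(i_k)\in\mathbb{R}^{r_k\times r_{k+1}}$ is the $i_k$th lateral slice of $\mathcal{Z}_k$, i.e. the matrix with entries $\mathcal{Z}_k(\alpha,i_k,\beta)$. The slices $\mathbf{Y}_k(i_k)$ and $\mathbf{X}_k(i_k)$ of $\mathcal{Y}_k$ and $\mathcal{X}_k$ are defined in the same way, with $s_{d+1}=s_1$ and $q_{d+1}=q_1$. The symbol $\circledast$ denotes the Hadamard (entrywise) product of tensors of equal size, and $\otimes$ denotes the Kronecker product of matrices. *)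

(* Defs.v *)
From mathcomp Require Import all_boot all_order all_algebra.
From mathcomp Require Import reals.
From mathcomp Require Export mxtens.

Set Implicit Arguments.
Unset Strict Implicit.
Unset Printing Implicit Defensive.

Import GRing.Theory.
Local Open Scope ring_scope.

(* Modes are numbered from 0: the k-th core, k : 'I_d, is the (k+1)-st of the
   usual 1-based numbering.  Ranks are given by r : nat -> nat, of which only
   r 0, ..., r d matter; r d = r 0 closes the ring. *)

Definition tensor (R : Type) (d : nat) (n : 'I_d -> nat) : Type :=
  {ffun {dffun forall k : 'I_d, 'I_(n k)} -> R}.

Definition core (R : Type) (a m b : nat) : Type :=
  {ffun 'I_a * 'I_m * 'I_b -> R}.

Definition slice (R : Type) (a m b : nat) (Z : core R a m b) (i : 'I_m) :
    'M[R]_(a, b) :=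
  \matrix_(alpha < a, beta < b) Z (alpha, i, beta).

Definition hadamard (R : pzRingType) (d : nat) (n : 'I_d -> nat)
    (T1 T2 : tensor R n) : tensor R n :=
  [ffun i => T1 i * T2 i].

(* A_0 *m A_1 *m ... *m A_(d-1).  Since r is a function on nat, the sizes agree
   by conversion and no cast is needed. *)
Fixpoint mxchain (R : pzRingType) (r : nat -> nat) (d : nat) :
    (forall k : 'I_d, 'M[R]_(r k, r k.+1)) -> 'M[R]_(r 0, r d) :=
  match d with
  | 0 => fun _ => 1%:M
  | d'.+1 => fun A =>
      mxchain (fun k : 'I_d' => A (widen_ord (leqnSn d') k)) *m A ord_max
  end.

(* The cast along r d = r 0 makes the product square, so that it has a trace. *)
Definition tensor_ring (R : pzRingType) (d : nat) (n : 'I_d -> nat)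
    (r : nat -> nat) (hr : r d = r 0)
    (Z : forall k : 'I_d, core R (r k) (n k) (r k.+1)) : tensor R n :=
  [ffun i : {dffun forall k : 'I_d, 'I_(n k)} =>
     \tr (castmx (erefl (r 0), hr) (mxchain (fun k => slice (Z k) (i k))))].

(* Main.v *)
Require Import Defs.
From mathcomp Require Import all_boot all_order all_algebra.
From mathcomp Require Import reals.

(** Each entry of a tensor ring is the trace of a product of slices, and the
    trace turns Kronecker products into products of scalars:
    tr (A *t B) = tr A * tr B ([mxtrace_tens]).  So the entry of the Hadamard
    product is the trace of the Kronecker product of two chains of slices.  By
    the mixed product rule (A *t B) *m (C *t D) = (A *m C) *t (B *m D), that
    Kronecker product of chains is the chain of the slicewise Kronecker
    products ([mxchain_tens]), that is, the chain built from the cores whose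
    slices are Z_k(i) *t Y_k(i).  The ring-closing cast is compatible with the
    Kronecker product ([castmx_tens]). *)

Set Implicit Arguments.
Unset Strict Implicit.
Unset Printing Implicit Defensive.

Import GRing.Theory.
Local Open Scope ring_scope.

Lemma tens1mx1 (R : pzRingType) (m n : nat) :
  1%:M *t 1%:M = 1%:M :> 'M[R]_(m * n).
Proof.
apply/matrixP=> i j.
case: (mxtens_indexP i) => i1 i2; case: (mxtens_indexP j) => j1 j2.
by rewrite tensmxE !mxE (can_eq (@mxtens_indexK m n)) xpair_eqE -natrM mulnb.
Qed.

Lemma mxtrace_tens (R : pzRingType) (m n : nat) (A : 'M[R]_m) (B : 'M[R]_n) :
  \tr (A *t B) = \tr A * \tr B.
Proof.
by rewrite /mxtrace mulr_sum; apply: eq_bigr => i _; rewrite mxE.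
Qed.

(** The dimensions b' and c' are free variables so that both equations can be
    eliminated; neither side of the instance r d = r 0 is a variable, so a
    direct case analysis on that equation is impossible. *)
Lemma castmx_tens (R : pzRingType) (a a' b b' c c' : nat)
    (eb : b = b') (ec : c = c')
    (A : 'M[R]_(a, b)) (B : 'M[R]_(a', c)) :
  castmx (erefl (a * a')%N, f_equal2 muln eb ec) (A *t B) =
    castmx (erefl a, eb) A *t castmx (erefl a', ec) B.
Proof. by case: b' / eb; case: c' / ec; rewrite !castmx_id. Qed.

(** Commutativity of the scalars enters through the mixed product rule, which
    moves the entries of one chain past those of the other. *)
Lemma mxchain_tens (R : comPzRingType) (r s : nat -> nat) (d : nat)
    (A : forall k : 'I_d, 'M[R]_(r k, r k.+1))
    (B : forall k : 'I_d, 'M[R]_(s k, s k.+1)) :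
  mxchain (r := fun k => (r k * s k)%N) (fun k => A k *t B k) =
    mxchain A *t mxchain B.
Proof.
elim: d A B => [|d IHd] A B /=; first by rewrite tens1mx1.
by rewrite -tensmx_mul -IHd.
Qed.

Lemma eq_mxchain (R : pzRingType) (r : nat -> nat) (d : nat)
    (A B : forall k : 'I_d, 'M[R]_(r k, r k.+1)) :
  (forall k, A k = B k) -> mxchain A = mxchain B.
Proof.
elim: d A B => [//|d IHd] A B eqAB /=.
by rewrite eqAB (IHd _ _ (fun k => eqAB (widen_ord (leqnSn d) k))).
Qed.

Definition tens_core (R : pzRingType) (a b m a' b' : nat)
    (Z : core R a m b) (Y : core R a' m b') : core R (a * a') m (b * b') :=
  [ffun t => (slice Z t.1.2 *t slice Y t.1.2) t.1.1 t.2].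

Lemma slice_tens_core (R : pzRingType) (a b m a' b' : nat)
    (Z : core R a m b) (Y : core R a' m b') (i : 'I_m) :
  slice (tens_core Z Y) i = slice Z i *t slice Y i.
Proof. by apply/matrixP=> x y; rewrite mxE ffunE. Qed.

Theorem theorem5 (R : realType) (d : nat) (n : 'I_d -> nat)
    (r s : nat -> nat) (hr : r d = r 0%N) (hs : s d = s 0%N)
    (T1 T2 : tensor R n)
    (Z : forall k : 'I_d, core R (r k) (n k) (r k.+1))
    (Y : forall k : 'I_d, core R (s k) (n k) (s k.+1)) :
  T1 = tensor_ring hr Z ->
  T2 = tensor_ring hs Y ->
  exists X : forall k : 'I_d,
      core R (r k * s k)%N (n k) (r k.+1 * s k.+1)%N,
    (forall (k : 'I_d) (i : 'I_(n k)),
       slice (X k) i = slice (Z k) i *t slice (Y k) i) /\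
    hadamard T1 T2 =
      tensor_ring (r := fun k => (r k * s k)%N) (f_equal2 muln hr hs) X.
Proof.
move=> -> ->; exists (fun k => tens_core (Z k) (Y k)).
split=> [k i|]; first exact: slice_tens_core.
apply/ffunP=> i; rewrite !ffunE -mxtrace_tens -castmx_tens -mxchain_tens.
congr (\tr (castmx _ _)); apply: eq_mxchain => k.
by rewrite slice_tens_core.
Qed.
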